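(* For every integer $n\ge 0$ there is a set $\mathrm{Paths}_n$ of centered paths, whose vertices are elements of $\mathrm{RV}^+_{n;2}$, such that the vertex sets $V(P)$, $P\in\mathrm{Paths}_n$, are pairwise disjoint with union $\mathrm{RV}^+_{n;2}$, and for every $P\in\mathrm{Paths}_n$: (i) $\mathrm{rad}(P)\equiv 0\pmod 2$; (ii) if $P(j)=T$ then $\mathrm{ind}(T)=j$; (iii) if $T\in V(P)$ then $\mathrm{rad}(P)=\mathrm{rad}(T)$.
   Context: Centered path: for an integer $r\ge 0$, a centered path $P$ of radius $\mathrm{rad}(P)=r$ consists of $r+1$ distinct vertices indexed $P(-r),P(-r+2),\dots,P(r-2),P(r)$ with directed edges $P(-r+2i)\to P(-r+2i+2)$ for $0\le i<r$; $V(P)$ is its vertex set. $\tau(i)=|i+1|-1$. For integers $r_1,r_2\ge 0$ and $x,y$: $\rho(r_1,r_2,x,y)=r_1+y$ if $y\ge -x+r_2-r_1$, and $\rho(r_1,r_2,x,y)=r_2-x$ if $y<-x+r_2-r_1$. Radius-value trees: a height-$0$ tree is a single vertex labeled by an even integer (its value). A height-$(n+1)$ tree is $T=(l,T_1,T_2,T_3)$ with $l$ even, $T_i$ radius-value trees of height $n$, and $|l-\mathrm{val}(T_1)-\mathrm{val}(T_3)|\le\tau(\mathrm{val}(T_2))$; $\mathrm{val}(T)=l$. $\mathrm{RV}_{n;2}$ is the set of height-$n$ trees all of whose leaves are labeled $2$. For $T\in\mathrm{RV}_{n;2}$, $\mathrm{ind}(T)=\mathrm{val}(T)-2^{n+1}$.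 The radius: $\mathrm{rad}(T)=0$ for height $0$; for trees $T_1,T_3$ put $\mathrm{rad}(T_1,T_3)=\rho(\mathrm{rad}(T_1),\mathrm{rad}(T_3),\mathrm{ind}(T_1),\mathrm{ind}(T_3))$, and for $T=(l,T_1,T_2,T_3)$ with $j=l-\mathrm{val}(T_1)-\mathrm{val}(T_3)$, $\mathrm{rad}(T)=\rho(\mathrm{rad}(T_1,T_3),\tau(\mathrm{val}(T_2)),\mathrm{ind}(T_1)+\mathrm{ind}(T_3),j)$. Define $\mathrm{RV}^+_{0;2}=\mathrm{RV}_{0;2}$ and, for $n\ge1$, $\mathrm{RV}^+_{n;2}$ is the set of $T=(l,T_1,T_2,T_3)\in\mathrm{RV}_{n;2}$ with $T_1,T_2,T_3\in\mathrm{RV}^+_{n-1;2}$ and $\mathrm{val}(T_2)\ge\max(\mathrm{rad}(T_2)-2^n,0)$. *)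

(* Defs.v *)
From HB Require Import structures.
From mathcomp Require Import all_boot all_order all_algebra.
From mathcomp Require Import boolp classical_sets.

Set Implicit Arguments.
Unset Strict Implicit.
Unset Printing Implicit Defensive.

Import Order.TTheory GRing.Theory Num.Theory.

Local Open Scope classical_set_scope.
Local Open Scope ring_scope.

(* The vertex of index -r + 2i is [cpt i]; the edges are determined by the
   indexing, see [cpath_edge]. *)
Record cpath (V : Type) := CPath {
  crad : nat;
  cpt : 'I_crad.+1 -> V;
  cpt_inj : injective cpt
}.

Definition cpath_verts (V : Type) (P : cpath V) : set V := range (@cpt V P).

(* P(j) = v; no vertex has index j unless |j| <= crad P and j = crad P mod 2. *)
Definition cpath_at (V : Type) (P : cpath V) (j : int) (v : V) : Prop :=
  exists i : 'I_(crad P).+1,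
    j = - (crad P)%:Z + 2 * (i : nat)%:Z /\ cpt i = v.

Definition cpath_edge (V : Type) (P : cpath V) (u v : V) : Prop :=
  exists j : int, cpath_at P j u /\ cpath_at P (j + 2) v.

Definition rv_tau (i : int) : int := `|i + 1| - 1.

Definition rv_rho (r1 r2 x y : int) : int :=
  if - x + r2 - r1 <= y then r1 + y else r2 - x.

(* Raw labeled ternary trees; the conditions making them radius-value trees
   are imposed by [is_rvtree]. *)
Inductive rvraw : Type :=
| Leaf of int
| Node of int & rvraw & rvraw & rvraw.

Definition rv_val (T : rvraw) : int :=
  match T with Leaf l => l | Node l _ _ _ => l end.

(* Meaningful on trees satisfying [is_rvtree n] for some n, where all branches
   have the same length. *)
Fixpoint rv_height (T : rvraw) : nat :=
  match T with Leaf _ => 0%N | Node _ T1 _ _ => (rv_height T1).+1 end.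

Fixpoint is_rvtree (n : nat) (T : rvraw) : Prop :=
  match n, T with
  | 0%N, Leaf l => (2 %| l)%Z
  | m.+1, Node l T1 T2 T3 =>
      [/\ (2 %| l)%Z, is_rvtree m T1, is_rvtree m T2, is_rvtree m T3 &
          `|l - rv_val T1 - rv_val T3| <= rv_tau (rv_val T2)]
  | _, _ => False
  end.

Fixpoint leaves_eq (a : int) (T : rvraw) : Prop :=
  match T with
  | Leaf l => l = a
  | Node _ T1 T2 T3 => [/\ leaves_eq a T1, leaves_eq a T2 & leaves_eq a T3]
  end.

Definition RV2 (n : nat) : set rvraw :=
  [set T | is_rvtree n T /\ leaves_eq 2 T].

Definition rv_ind (T : rvraw) : int := rv_val T - 2 ^+ (rv_height T).+1.

Fixpoint rv_rad (T : rvraw) : int :=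
  match T with
  | Leaf _ => 0
  | Node l T1 T2 T3 =>
      let rad13 := rv_rho (rv_rad T1) (rv_rad T3) (rv_ind T1) (rv_ind T3) in
      rv_rho rad13 (rv_tau (rv_val T2)) (rv_ind T1 + rv_ind T3) (l - rv_val T1 - rv_val T3)
  end.

Fixpoint RV2plus (n : nat) : set rvraw :=
  match n with
  | 0%N => RV2 0
  | m.+1 => [set T | RV2 m.+1 T /\
      exists l T1 T2 T3,
        [/\ T = Node l T1 T2 T3, RV2plus m T1, RV2plus m T2, RV2plus m T3 &
            Num.max (rv_rad T2 - 2 ^+ m.+1) 0 <= rv_val T2]]
  end.

(* Main.v *)
Require Import Defs.
From HB Require Import structures.
From mathcomp Require Import all_boot all_order all_algebra.
From mathcomp Require Import boolp classical_sets.
From mathcomp Require Import zify.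

(* A set with index and radius functions splits into centered paths as soon as
   it carries mutually inverse partial operators moving the index by 2 at
   constant radius, defined except where the index is extremal, i.e. equal to
   the radius up to sign: it is then a crystal of sl_2, the index being the
   weight and the radius the highest weight of the component. Since
   rho(r1, r2, x, y) = max(r1 + y, r2 - x), the radius rule of trees is that of
   Kashiwara's tensor product of crystals. A tree of RV^+_{n+1;2} amounts to a
   pair (T1, T3), a middle tree T2 and an even j with |j| <= val(T2); its index
   and radius are those of the tensor product of the crystals of T1, of T3 and
   of the strings -val(T2), ..., val(T2). *)

Set Implicit Arguments.
Unset Strict Implicit.
Unset Printing Implicit Defensive.

Import Order.TTheory GRing.Theory Num.Theory.

Local Open Scope classical_set_scope.
Local Open Scope ring_scope.

Lemma cpath_eq (V : Type) (P Q : cpath V) : crad P = crad Q ->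
  (forall (i : 'I_(crad P).+1) (j : 'I_(crad Q).+1),
     i = j :> nat -> cpt i = cpt j) ->
  P = Q.
Proof.
case: P Q => [r p pI] [s q qI] /= rs; subst s => pq.
have {}pq : p = q by apply/funext => i; exact: pq.
by subst q; congr CPath; exact: Prop_irrelevance.
Qed.

Lemma rv_rhoE (r1 r2 x y : int) : rv_rho r1 r2 x y = Num.max (r1 + y) (r2 - x).
Proof. by rewrite /rv_rho; case: ifPn => ?; lia. Qed.

Lemma rv_tau_ge0 (i : int) : 0 <= i -> rv_tau i = i.
Proof. by rewrite /rv_tau; lia. Qed.

Record graded (V : Type) := Graded {
  grd_set : set V;
  grd_ind : V -> int;
  grd_rad : V -> int
}.

Definition dual (V : Type) (G : graded V) : graded V :=
  Graded (grd_set G) (\- grd_ind G) (grd_rad G).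

Lemma dualK (V : Type) : involutive (@dual V).
Proof.
by case=> S ind rad; congr Graded; apply/funext => v /=; rewrite opprK.
Qed.

Definition raises (V : Type) (G : graded V) (e f : V -> V) : Prop :=
  forall v, grd_set G v -> grd_ind G v < grd_rad G v ->
    [/\ grd_set G (e v), grd_ind G (e v) = grd_ind G v + 2,
        grd_rad G (e v) = grd_rad G v & f (e v) = v].

Definition centered (V : Type) (G : graded V) : Prop :=
  forall v, grd_set G v ->
    (2 %| grd_rad G v - grd_ind G v)%Z /\ `|grd_ind G v| <= grd_rad G v.

Lemma centered_dual (V : Type) (G : graded V) :
  centered G -> centered (dual G).
Proof. by move=> centeredG v /centeredG /= [? ?]; lia. Qed.

(* The lowering operator [f] is a raising operator of the dual. *)
Definition crystal (V : Type) (G : graded V) : Prop :=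
  centered G /\ exists e f, raises G e f /\ raises (dual G) f e.

Lemma iter_raises (V : Type) (G : graded V) (e f : V -> V) (k : nat) (v : V) :
  raises G e f -> grd_set G v -> grd_ind G v + 2 * k%:Z <= grd_rad G v ->
  [/\ grd_set G (iter k e v), grd_ind G (iter k e v) = grd_ind G v + 2 * k%:Z,
      grd_rad G (iter k e v) = grd_rad G v & iter k f (iter k e v) = v].
Proof.
move=> raise_e Gv; elim: k => [|k IHk] le_k; first by split=> //=; lia.
have [|Gk ind_k rad_k fk_ek] := IHk; first by lia.
have [|Gk1 ind_k1 rad_k1 f_e] := raise_e _ Gk; first by lia.
split; rewrite ?iterS ?ind_k1 ?rad_k1 //; first by lia.
by rewrite -iterS iterSr /= f_e.
Qed.

Section Strings.

Variables (V : Type) (G : graded V) (e f : V -> V).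
Hypothesis centeredG : centered G.
Hypothesis raise_e : raises G e f.
Hypothesis lower_f : raises (dual G) f e.

Definition is_string (P : cpath V) : Prop :=
  let v := cpt (c := P) ord0 in
  [/\ grd_set G v, grd_ind G v = - grd_rad G v, (crad P)%:Z = grd_rad G v &
      forall i, cpt (c := P) i = iter i e v].

Lemma string_cpt (P : cpath V) (i : 'I_(crad P).+1) : is_string P ->
  [/\ grd_set G (cpt i), grd_ind G (cpt i) = - (crad P)%:Z + 2 * (i : nat)%:Z,
      grd_rad G (cpt i) = (crad P)%:Z & iter i f (cpt i) = cpt (c := P) ord0].
Proof.
case=> G0 ind0 rad0 ->.
have := iter_raises (k := i) raise_e G0; rewrite ind0 -rad0; apply.
by have := ltn_ord i; lia.
Qed.

Lemma string_of_lowest (v : V) : grd_set G v -> grd_ind G v = - grd_rad G v ->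
  exists2 P, is_string P & cpt (c := P) ord0 = v.
Proof.
move=> Gv lowest; have [_ bound] := centeredG Gv.
have radE : `|grd_rad G v|%N%:Z = grd_rad G v by lia.
have ind_iter (i : 'I_(`|grd_rad G v|%N).+1) :
    grd_ind G (iter i e v) = grd_ind G v + 2 * (i : nat)%:Z.
  by case: (iter_raises (k := i) raise_e Gv) => //; have := ltn_ord i; lia.
have iter_inj : injective (fun i : 'I_(`|grd_rad G v|%N).+1 => iter i e v).
  move=> i j eq_ij; apply/val_inj => /=.
  by have := ind_iter i; rewrite eq_ij ind_iter; lia.
by exists (CPath iter_inj).
Qed.

Lemma string_through (v : V) : grd_set G v ->
  exists2 P, is_string P & cpath_verts P v.
Proof.
move=> Gv; have [parity bound] := centeredG Gv.
pose k := `|((grd_ind G v + grd_rad G v) %/ 2)%Z|%N.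
have kE : 2 * k%:Z = grd_ind G v + grd_rad G v by rewrite /k; lia.
have [/=|Gk ind_k rad_k ek_fk] := iter_raises (k := k) lower_f Gv.
  by lia.
rewrite /= in ind_k rad_k.
have [|P stringP P0] := string_of_lowest Gk; first by lia.
exists P => //; case: stringP => _ _ + iterP; rewrite P0 rad_k => radP.
have lt_k : (k < (crad P).+1)%N by lia.
by exists (Ordinal lt_k) => //; rewrite iterP P0.
Qed.

Lemma string_meet_eq (P Q : cpath V) : is_string P -> is_string Q ->
  cpath_verts P `&` cpath_verts Q !=set0 -> P = Q.
Proof.
move=> stringP stringQ [u [[i _ Pi] [j _ Qj]]].
have [_ + + fi] := string_cpt i stringP.
have [_ + + fj] := string_cpt j stringQ.
rewrite Pi Qj => ind_j rad_j ind_i rad_i.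
have eq_ij : i = j :> nat by lia.
have eq0 : cpt (c := P) ord0 = cpt (c := Q) ord0 by rewrite -fi -fj Pi Qj eq_ij.
case: stringP stringQ => _ _ _ iterP [_ _ _ iterQ].
by apply: cpath_eq => [|k l kl]; [lia | rewrite iterP iterQ eq0 kl].
Qed.

End Strings.

Lemma crystal_cpaths (V : Type) (G : graded V) : crystal G ->
  exists Paths : set (cpath V),
    [/\ trivIset Paths (@cpath_verts V),
        \bigcup_(P in Paths) cpath_verts P = grd_set G &
        forall P : cpath V, Paths P ->
          (forall (j : int) (v : V), cpath_at P j v -> grd_ind G v = j) /\
          (forall v : V, cpath_verts P v -> (crad P)%:Z = grd_rad G v)].
Proof.
case=> centeredG [e [f [raise_e lower_f]]].
exists (is_string G e); split.
- by move=> P Q ? ?; exact: (string_meet_eq raise_e).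
- apply/seteqP; split=> [v [P stringP [i _ <-]] | v Gv].
    by case: (string_cpt raise_e i stringP).
  by have [P] := string_through centeredG raise_e lower_f Gv; exists P.
- move=> P stringP; split=> [j _ [i [-> <-]] | _ [i _ <-]].
    by case: (string_cpt raise_e i stringP).
  by case: (string_cpt raise_e i stringP).
Qed.

Definition graded_bij (V W : Type) (G : graded V) (H : graded W)
    (phi : V -> W) (psi : W -> V) : Prop :=
  (forall v, grd_set G v ->
     [/\ grd_set H (phi v), psi (phi v) = v,
         grd_ind H (phi v) = grd_ind G v & grd_rad H (phi v) = grd_rad G v]) /\
  (forall w, grd_set H w -> grd_set G (psi w) /\ phi (psi w) = w).

Lemma graded_bij_dual (V W : Type) (G : graded V) (H : graded W)
    (phi : V -> W) (psi : W -> V) :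
  graded_bij G H phi psi -> graded_bij (dual G) (dual H) phi psi.
Proof.
by case=> phiP psiP; split=> // v /phiP[? ? ind_phi ?]; rewrite /= ind_phi.
Qed.

Lemma raises_transfer (V W : Type) (G : graded V) (H : graded W)
    (phi : V -> W) (psi : W -> V) (e f : W -> W) :
  graded_bij G H phi psi -> raises H e f ->
  raises G (psi \o e \o phi) (psi \o f \o phi).
Proof.
case=> phiP psiP raise_e v Gv; case: (phiP _ Gv) => Hv psiK <- <- lt_v.
have [He ind_e rad_e f_e] := raise_e _ Hv lt_v.
have [Ge phiK] := psiP _ He; have [_ _ <- <-] := phiP _ Ge.
by rewrite /= phiK f_e.
Qed.

Lemma crystal_transfer (V W : Type) (G : graded V) (H : graded W)
    (phi : V -> W) (psi : W -> V) :
  graded_bij G H phi psi -> crystal H -> crystal G.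
Proof.
move=> bij [centeredH [e [f [raise_e lower_f]]]]; split.
  by move=> v /(proj1 bij)[Hv _ <- <-]; exact: centeredH.
exists (psi \o e \o phi), (psi \o f \o phi).
split; first exact: raises_transfer raise_e.
exact: raises_transfer (graded_bij_dual bij) lower_f.
Qed.

Lemma crystal_zero (V : Type) (G : graded V) :
  (forall v, grd_set G v -> grd_ind G v = 0 /\ grd_rad G v = 0) -> crystal G.
Proof.
move=> G0; split; first by move=> v /G0[-> ->].
by exists id, id; split=> v /G0 /= [-> ->].
Qed.

Definition string_bundle (V : Type) (S : set V) (r : V -> int) :
    graded (V * int) :=
  Graded [set u | [/\ S u.1, (2 %| r u.1 - u.2)%Z & `|u.2| <= r u.1]]
    snd (r \o fst).

Lemma crystal_string_bundle (V : Type) (S : set V) (r : V -> int) :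
  crystal (string_bundle S r).
Proof.
split; first by case=> v j [].
exists (fun u => (u.1, u.2 + 2)), (fun u => (u.1, u.2 - 2)).
split=> -[v j] [/= Sv parity bound] lt_j.
- by split=> //=; [split=> //=; lia | congr pair; lia].
- by split=> //=; [split=> //=; lia | lia | congr pair; lia].
Qed.

Definition tensor (V W : Type) (G : graded V) (H : graded W) : graded (V * W) :=
  Graded (grd_set G `*` grd_set H) (fun u => grd_ind G u.1 + grd_ind H u.2)
    (fun u => rv_rho (grd_rad G u.1) (grd_rad H u.2)
                     (grd_ind G u.1) (grd_ind H u.2)).

Definition tensor_raise (V W : Type) (G : graded V) (H : graded W)
    (e1 : V -> V) (e2 : W -> W) (u : V * W) : V * W :=
  if grd_rad H u.2 - grd_ind G u.1 <= grd_rad G u.1 + grd_ind H u.2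
  then (e1 u.1, u.2) else (u.1, e2 u.2).

Definition tensor_lower (V W : Type) (G : graded V) (H : graded W)
    (f1 : V -> V) (f2 : W -> W) : V * W -> V * W :=
  swap_pair \o tensor_raise (dual H) (dual G) f2 f1 \o swap_pair.

Lemma tensor_lowerE (V W : Type) (G : graded V) (H : graded W)
    (f1 : V -> V) (f2 : W -> W) (u : V * W) :
  tensor_lower G H f1 f2 u =
  if grd_rad G u.1 + grd_ind H u.2 <= grd_rad H u.2 - grd_ind G u.1
  then (u.1, f2 u.2) else (f1 u.1, u.2).
Proof. by rewrite /tensor_lower /tensor_raise /= opprK; case: ifP. Qed.

Lemma tensor_lower_dual (V W : Type) (G : graded V) (H : graded W)
    (e1 : V -> V) (e2 : W -> W) :
  swap_pair \o tensor_lower (dual H) (dual G) e2 e1 \o swap_pair =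
  tensor_raise G H e1 e2.
Proof.
rewrite /tensor_lower !dualK; apply/funext => -[v w].
by rewrite /= /swap_pair /= -surjective_pairing.
Qed.

Lemma tensor_swap (V W : Type) (G : graded V) (H : graded W) :
  graded_bij (dual (tensor G H)) (tensor (dual H) (dual G)) swap_pair swap_pair.
Proof.
split=> [[v w] [/= Gv Hw] | [w v] [/= Hw Gv]] //=.
by rewrite !rv_rhoE; split=> //; lia.
Qed.

Lemma centered_tensor (V W : Type) (G : graded V) (H : graded W) :
  centered G -> centered H -> centered (tensor G H).
Proof.
move=> centeredG centeredH [v w] [/= /centeredG[? ?] /centeredH[? ?]].
by rewrite rv_rhoE; lia.
Qed.

Lemma raises_tensor (V W : Type) (G : graded V) (H : graded W)
    (e1 f1 : V -> V) (e2 f2 : W -> W) :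
  centered G -> centered H -> raises G e1 f1 -> raises H e2 f2 ->
  raises (tensor G H) (tensor_raise G H e1 e2) (tensor_lower G H f1 f2).
Proof.
move=> centeredG centeredH raise1 raise2 [v w] [/= Gv Hw].
have [parityv boundv] := centeredG _ Gv.
have [parityw boundw] := centeredH _ Hw.
rewrite tensor_lowerE /tensor_raise !rv_rhoE /= => lt_ind.
case: leP => [le_first|lt_second].
- have [|Ge ind_e rad_e f_e] := raise1 _ Gv; first by lia.
  by rewrite /= !ind_e !rad_e f_e ifN; [split=> //; lia | lia].
(* By parity the strict inequality [lt_second] leaves room for raising the index
   of [w] by 2, so lowering then acts on the second factor again. *)
- have [|He ind_e rad_e f_e] := raise2 _ Hw; first by lia.
  by rewrite /= !ind_e !rad_e f_e ifT; [split=> //; lia | lia].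
Qed.

Lemma crystal_tensor (V W : Type) (G : graded V) (H : graded W) :
  crystal G -> crystal H -> crystal (tensor G H).
Proof.
case=> centeredG [e1 [f1 [raise1 lower1]]].
case=> centeredH [e2 [f2 [raise2 lower2]]].
split; first exact: centered_tensor.
exists (tensor_raise G H e1 e2), (tensor_lower G H f1 f2).
split; first exact: raises_tensor.
rewrite -tensor_lower_dual; apply: raises_transfer (tensor_swap G H) _.
by apply: raises_tensor lower2 lower1; exact: centered_dual.
Qed.

Lemma rvtree_height (n : nat) (T : rvraw) : is_rvtree n T -> rv_height T = n.
Proof. by elim: n T => [|n IHn] [l|l T1 T2 T3] //= [_ /IHn ->]. Qed.

Lemma rvtree_even (n : nat) (T : rvraw) : is_rvtree n T -> (2 %| rv_val T)%Z.
Proof. by case: n T => [|n] [l|l T1 T2 T3] //= []. Qed.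

Lemma RV2plus_sub (n : nat) : RV2plus n `<=` RV2 n.
Proof. by case: n => [|n] T // []. Qed.

Lemma RV2plus_even (n : nat) (T : rvraw) : RV2plus n T -> (2 %| rv_val T)%Z.
Proof. by move=> /RV2plus_sub[/rvtree_even]. Qed.

Lemma RV2plus_ind (n : nat) (T : rvraw) :
  RV2plus n T -> rv_ind T = rv_val T - 2 ^+ n.+1.
Proof. by move=> /RV2plus_sub[/rvtree_height hT _]; rewrite /rv_ind hT. Qed.

Lemma RV2plus_ind_even (n : nat) (T : rvraw) :
  RV2plus n T -> (2 %| rv_ind T)%Z.
Proof.
move=> plusT; have := RV2plus_even plusT.
by rewrite (RV2plus_ind plusT) exprS; lia.
Qed.

Lemma RV2plus0 : RV2plus 0 = [set Leaf 2].
Proof. by apply/seteqP; split=> [[l|l T1 T2 T3] [] //= _ -> | _ ->]. Qed.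

Definition RV2middle (n : nat) : set rvraw :=
  [set T | RV2plus n T /\ Num.max (rv_rad T - 2 ^+ n.+1) 0 <= rv_val T].

Lemma RV2plusS (n : nat) (l : int) (T1 T2 T3 : rvraw) :
  RV2plus n.+1 (Node l T1 T2 T3) <->
  [/\ RV2plus n T1, RV2middle n T2, RV2plus n T3, (2 %| l)%Z &
      `|l - rv_val T1 - rv_val T3| <= rv_val T2].
Proof.
split=> [[[[even_l _ _ _ bound] _] [? [? [? [? [[_ <- <- <-]]]]]]] | ].
  move=> plus1 plus2 plus3 max_le.
  by split=> //; rewrite -[rv_val T2]rv_tau_ge0 //; lia.
case=> plus1 [plus2 max_le] plus3 even_l bound.
have [tree1 leaves1] := RV2plus_sub plus1.
have [tree2 leaves2] := RV2plus_sub plus2.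
have [tree3 leaves3] := RV2plus_sub plus3.
split; last by exists l, T1, T2, T3.
by split=> //=; split=> //; rewrite rv_tau_ge0 //; lia.
Qed.

Lemma RV2plus_ind_node (n : nat) (l : int) (T1 T2 T3 : rvraw) :
  RV2plus n.+1 (Node l T1 T2 T3) ->
  rv_ind (Node l T1 T2 T3) =
    rv_ind T1 + rv_ind T3 + (l - rv_val T1 - rv_val T3).
Proof.
move=> plusT; have [plus1 _ plus3 _ _] := (RV2plusS _ _ _ _ _).1 plusT.
rewrite (RV2plus_ind plusT) (RV2plus_ind plus1) (RV2plus_ind plus3) /=.
by rewrite (exprS _ n.+1); lia.
Qed.

Definition RV2plus_graded (n : nat) : graded rvraw :=
  Graded (RV2plus n) rv_ind rv_rad.

Definition node_graded (n : nat) : graded ((rvraw * rvraw) * (rvraw * int)) :=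
  tensor (tensor (RV2plus_graded n) (RV2plus_graded n))
    (string_bundle (RV2middle n) rv_val).

Definition rv_split (T : rvraw) : (rvraw * rvraw) * (rvraw * int) :=
  match T with
  | Leaf _ => ((T, T), (T, 0))
  | Node l T1 T2 T3 => ((T1, T3), (T2, l - rv_val T1 - rv_val T3))
  end.

Definition rv_join (u : (rvraw * rvraw) * (rvraw * int)) : rvraw :=
  Node (u.2.2 + rv_val u.1.1 + rv_val u.1.2) u.1.1 u.2.1 u.1.2.

Lemma rv_split_bij (n : nat) :
  graded_bij (RV2plus_graded n.+1) (node_graded n) rv_split rv_join.
Proof.
split=> [[l|l T1 T2 T3] | [[T1 T3] [T2 j]] [[/= plus1 plus3]]].
- by case=> -[].
- move=> plusT; have indT := RV2plus_ind_node plusT.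
  case/RV2plusS: plusT => plus1 middle2 plus3 even_l bound.
  have [even1 even3] := (RV2plus_even plus1, RV2plus_even plus3).
  have even2 := RV2plus_even middle2.1.
  split.
  + by split=> //; split=> //=; lia.
  + by congr Node; rewrite /=; lia.
  + by rewrite [RHS]indT.
  + by rewrite /= rv_tau_ge0 //; lia.
- case=> middle2 parity bound.
  have [even1 even3] := (RV2plus_even plus1, RV2plus_even plus3).
  have even2 := RV2plus_even middle2.1.
  split; last by congr (_, (_, _)); lia.
  by apply/RV2plusS; split=> //=; lia.
Qed.

Lemma crystal_RV2plus (n : nat) : crystal (RV2plus_graded n).
Proof.
elim: n => [|n IHn].
  by apply: crystal_zero; rewrite [grd_set _]RV2plus0 => _ ->.
apply: crystal_transfer (rv_split_bij n) _.
apply: crystal_tensor (crystal_string_bundle _ _).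
exact: crystal_tensor.
Qed.

Theorem theorem5p3 (n : nat) :
  exists Paths : set (cpath rvraw),
    [/\ trivIset Paths (@cpath_verts rvraw),
        \bigcup_(P in Paths) cpath_verts P = RV2plus n &
        forall P : cpath rvraw, Paths P ->
          [/\ crad P = 0 %[mod 2],
              forall (j : int) (T : rvraw), cpath_at P j T -> rv_ind T = j &
              forall T : rvraw, cpath_verts P T -> (crad P)%:Z = rv_rad T]].
Proof.
have [Paths [disjointP coverP pathsP]] := crystal_cpaths (crystal_RV2plus n).
exists Paths; split=> // P PathsP; have [indP radP] := pathsP P PathsP.
split=> //; set T0 := cpt (c := P) ord0.
have plusT0 : RV2plus n T0.
  by rewrite -[RV2plus n]coverP; exists P => //; exists ord0.
have ind0 : rv_ind T0 = - (crad P)%:Z.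
  by apply: indP; exists ord0; split=> //=; lia.
by have := RV2plus_ind_even plusT0; rewrite ind0; lia.
Qed.
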